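(* Let $X$ be a polynomial vector field of degree $d$ on $\mathbb{C}^2$. If $g$ is a derivative of an invariant algebraic curve $f$ of $X$, then $g/f$ is an exponential coefficient of $X$.
   Context: A polynomial vector field of degree $d$ on $\mathbb{C}^2$ is $X=a\,\frac{\partial}{\partial x}+b\,\frac{\partial}{\partial y}$ with $a,b\in\mathbb{C}[x,y]$ and $\max(\deg a,\deg b)=d$; it acts by $X(f)=a f_x+b f_y$. An algebraic curve $\{f=0\}$ (or simply $f$), $f\in\mathbb{C}[x,y]$, is invariant by $X$ if $X(f)/f$ is a polynomial. Curves are called distinct if pairwise they have no common factors; convergence of curves means convergence of the coefficients of the polynomials. For $f,g\in\mathbb{C}[x,y]$, $e=\exp(g/f)$ is an exponential factor of $X$ if $X(e)/e$ is a polynomial of degree at most $d-1$; then $g/f$ is called an exponential coefficient of $X$. Derivative: let $X_t$, $t\in(-\epsilon,\epsilon)$, be an analytic $1$-parameter family of vector fields of degree $d$ with $X_0=X$ such that, for each $t\neq0$, $X_t$ has two distinct invariant algebraic curves $f_t^{(1)},f_t^{(2)}$. Let $f$ be an invariant algebraic curve of $X$. Assume that $f_t^{(1)},f_t^{(2)}\to f$ as $t\to0$, and that for some positive integer $r$ $$\lim_{t\to0}\frac{f_t^{(2)}-f_t^{(1)}}{t^j}=0\ \ (j=1,\ldots,r-1),\qquad \lim_{t\to0}\frac{f_t^{(2)}-f_t^{(1)}}{t^r}\neq0 .$$ Then the polynomial given by the last limit is called a derivative of $f$. *)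

(* Defs.v *)
From mathcomp Require Import all_boot all_order all_algebra.
From mathcomp Require Import complex.
From mathcomp Require Import all_classical all_reals all_analysis.
(* The notations of mpoly clash with those of mathcomp-analysis. *)
From mathcomp Require Import -(notations) mpoly.

Set Implicit Arguments.
Unset Strict Implicit.
Unset Printing Implicit Defensive.

Import Order.TTheory GRing.Theory Num.Theory numFieldNormedType.Exports.

Local Open Scope classical_set_scope.
Local Open Scope ring_scope.
Local Open Scope complex_scope.

(* The complex field R[i], bundled as a numClosedFieldType: this is where the
   normed topology (and hence limits and complex derivatives) is inferred. *)
Definition Cx (R : realType) : numClosedFieldType := R[i].

Notation poly2 R := (mpoly 2 (Cx R)).

Section Defs.
Variable R : realType.
Implicit Types (d r j : nat) (f g h K L : poly2 R) (x y z : Cx R).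

Definition varx : 'I_2 := ord0.
Definition vary : 'I_2 := ord_max.

Definition ev2 f x y : Cx R := meval (fun i => if i == varx then x else y) f.

(* X = (a, b) stands for a d/dx + b d/dy. *)
Definition vfield : Type := (poly2 R * poly2 R)%type.

(* [mpoly.msize p] is deg p + 1, and 0 for p = 0. *)
Definition vf_has_degree d (X : vfield) : Prop :=
  maxn (mpoly.msize X.1) (mpoly.msize X.2) = d.+1.

Definition vf_app (X : vfield) f : poly2 R :=
  X.1 * mderiv varx f + X.2 * mderiv vary f.

(* The same action on a function of two complex variables; [_^`()%classic] is
   the one-variable complex derivative. *)
Definition vf_app_fun (X : vfield) (e : Cx R -> Cx R -> Cx R) x y : Cx R :=
  ev2 X.1 x y * (fun z => e z y)^`()%classic x +
  ev2 X.2 x y * (fun z => e x z)^`()%classic y.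

(* X(f)/f is the polynomial K. *)
Definition invariant_curve (X : vfield) f : Prop :=
  f != 0 /\ exists K, vf_app X f = K * f.

Definition factor h f : Prop := exists q : poly2 R, f = q * h.

Definition distinct_curves f g : Prop :=
  forall h, factor h f -> factor h g -> (mpoly.msize h <= 1)%N.

Definition cexp z : Cx R :=
  (expR (complex.Re z) * cos (complex.Im z)) +i*
  (expR (complex.Re z) * sin (complex.Im z)).

Definition exp_frac g f x y : Cx R := cexp (ev2 g x y / ev2 f x y).

(* e = exp(g/f) is a function on the complement of {f = 0}. The bound
   deg L <= d - 1 is [msize L <= d], so that L = 0 when d = 0. *)
Definition exponential_coefficient d (X : vfield) g f : Prop :=
  f != 0 /\
  exists2 L, (mpoly.msize L <= d)%N &
    forall x y, ev2 f x y != 0 ->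
      vf_app_fun X (exp_frac g f) x y / exp_frac g f x y = ev2 L x y.

Definition real_analytic_at (u : R -> Cx R) (t0 : R) : Prop :=
  exists2 rho : R, 0 < rho &
    exists c : nat -> Cx R, forall t : R, `|t - t0| < rho ->
      series (fun n => c n * (((t - t0) ^+ n)%:C : Cx R)) @ \oo --> u t.

Definition analytic_family d (eps : R) (Xt : R -> vfield) : Prop :=
  forall t : R, `|t| < eps ->
    vf_has_degree d (Xt t) /\
    (forall m, real_analytic_at (fun s => mcoeff m (Xt s).1) t /\
               real_analytic_at (fun s => mcoeff m (Xt s).2) t).

Definition coef_cvg0 (F : R -> poly2 R) (l : poly2 R) : Prop :=
  forall m, mcoeff m (F t) @[t --> (0 : R)^'] --> mcoeff m l.

Definition curve_derivative d (X : vfield) f g : Prop :=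
  exists (eps : R) (Xt : R -> vfield) (f1 f2 : R -> poly2 R) (r : nat),
    [/\ [/\ 0 < eps, analytic_family d eps Xt & Xt 0 = X],
        forall t : R, `|t| < eps -> t != 0 ->
          [/\ invariant_curve (Xt t) (f1 t), invariant_curve (Xt t) (f2 t)
            & distinct_curves (f1 t) (f2 t)],
        coef_cvg0 f1 f /\ coef_cvg0 f2 f
      & [/\ (0 < r)%N,
            forall j, (0 < j < r)%N ->
              coef_cvg0 (fun t => ((t ^+ j)%:C : Cx R)^-1 *: (f2 t - f1 t)) 0,
            coef_cvg0 (fun t => ((t ^+ r)%:C : Cx R)^-1 *: (f2 t - f1 t)) g
          & g != 0]].

End Defs.

(* Main.v *)
Require Import Defs.
From mathcomp Require Import all_boot all_order all_algebra.
From mathcomp Require Import complex.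
From mathcomp Require Import all_classical all_reals all_analysis.
From mathcomp Require Import -(notations) mpoly.
From mathcomp Require Import ring lra.
Set Implicit Arguments.
Unset Strict Implicit.
Unset Printing Implicit Defensive.
Import Order.TTheory GRing.Theory Num.Theory numFieldNormedType.Exports.

(** Write X_t, f1, f2 for the family and its two invariant curves, K1, K2 for
their cofactors, and h = (f2 - f1) / t^r, so that h tends to g. The equations
X_t(f1) = K1 f1 and X_t(f2) = K2 f2 combine into

   X_t(h) f1 - h X_t(f1) = ((K2 - K1) / t^r) f1 f2.

The coefficients of X_t, being analytic in t, are continuous at t = 0
([real_analytic_at_cvg]), so the left side converges coefficient by coefficient
to X(g) f - g X(f), and f1 f2 converges to f^2. Neither K1, K2 nor their difference quotient is known
to converge, and the degrees of f1 and f2 need not be bounded. But a cofactor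
of a vector field of degree d has degree at most d - 1 ([msize_cofactor]), so
the quotients (K2 - K1) / t^r live in a fixed finite-dimensional space, on which
multiplication by f^2 is injective. An injective linear map has a left inverse,
and the same left inverse, composed with multiplication by f1 f2, is close to
the identity for small t. Hence the quotients do converge
([coef_cvg_quotient]), to some L of degree at most d - 1, and

   X(g) f - g X(f) = L f^2                    ([curve_derivative_cofactor]).

This is X(g/f) = L, and X(exp(g/f)) / exp(g/f) = X(g/f) by the chain rule
([exponential_coefficient_of_eq]), which needs that the complex exponential,
given by its real and imaginary parts, is its own complex derivative
([is_derive_cexp]). *)

(** * Limits of polynomials, coefficient by coefficient *)

Section CoefficientLimits.
Local Open Scope classical_set_scope.
Local Open Scope ring_scope.
Variables (K : numFieldType) (n : nat) (T : Type) (F : set_system T).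
Context {FF : ProperFilter F}.
Implicit Types (P Q L : T -> mpoly n K) (p q l w : mpoly n K).

(** Convergence as formal power series: the degrees of the [P t] may grow. *)
Definition coef_cvg P p : Prop :=
  forall m, mcoeff m (P t) @[t --> F] --> mcoeff m p.

Lemma coef_cvg_unique P p q : coef_cvg P p -> coef_cvg P q -> p = q.
Proof.
move=> Pp Pq; apply/mpolyP => m.
exact: (cvg_unique (@norm_hausdorff _ K) (Pp m) (Pq m)).
Qed.

Lemma coef_cvgD P Q p q :
  coef_cvg P p -> coef_cvg Q q -> coef_cvg (fun t => P t + Q t) (p + q).
Proof.
move=> Pp Qq m; under eq_fun do rewrite mcoeffD.
by rewrite mcoeffD; apply: cvgD.
Qed.

Lemma coef_cvgB P Q p q :
  coef_cvg P p -> coef_cvg Q q -> coef_cvg (fun t => P t - Q t) (p - q).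
Proof.
move=> Pp Qq m; under eq_fun do rewrite mcoeffB.
by rewrite mcoeffB; apply: cvgB.
Qed.

Lemma cvg_sum_fin (I : Type) (r : seq I) (B : pred I) (u : I -> T -> K) (a : I -> K) :
  (forall i, B i -> u i t @[t --> F] --> a i) ->
  \sum_(i <- r | B i) u i t @[t --> F] --> \sum_(i <- r | B i) a i.
Proof. by move=> ua; apply: cvg_big => //; exact: add_continuous. Qed.

Lemma cvg_prod_fin (I : Type) (r : seq I) (B : pred I) (u : I -> T -> K) (a : I -> K) :
  (forall i, B i -> u i t @[t --> F] --> a i) ->
  \prod_(i <- r | B i) u i t @[t --> F] --> \prod_(i <- r | B i) a i.
Proof. by move=> ua; apply: cvg_big => //; exact: mul_continuous. Qed.

(** A coefficient of a product is a finite sum over monomials that are bounded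
by its own degree, so that unbounded degrees do no harm. *)
Lemma coef_cvgM P Q p q :
  coef_cvg P p -> coef_cvg Q q -> coef_cvg (fun t => P t * Q t) (p * q).
Proof.
move=> Pp Qq m; under eq_fun do rewrite mcoeffM.
by rewrite mcoeffM; apply: cvg_sum_fin => k _; apply: cvgM.
Qed.

Lemma coef_cvg_deriv i P p :
  coef_cvg P p -> coef_cvg (fun t => mderiv i (P t)) (mderiv i p).
Proof.
move=> Pp m; under eq_fun do rewrite mcoeff_deriv -mulr_natr.
by rewrite mcoeff_deriv -(mulr_natr (mcoeff _ _)); exact: cvgMr_tmp (Pp _).
Qed.

Lemma near_cvg_to (u v : T -> K) (a : K) :
  (\forall t \near F, u t = v t) -> u t @[t --> F] --> a -> v t @[t --> F] --> a.
Proof. by move=> uv ua; apply: cvg_trans ua; exact: near_eq_cvg. Qed.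

Lemma near_eq_coef_cvg P Q p :
  (\forall t \near F, P t = Q t) -> coef_cvg P p -> coef_cvg Q p.
Proof.
move=> PQ Pp m; apply: (near_cvg_to _ (Pp m)).
by apply: filterS PQ => t ->.
Qed.

Definition entry_cvg a b (M : T -> 'M[K]_(a, b)) (M0 : 'M[K]_(a, b)) : Prop :=
  forall i j, M t i j @[t --> F] --> M0 i j.

Lemma entry_cvgM a b c (M : T -> 'M[K]_(a, b)) M0 (N : T -> 'M[K]_(b, c)) N0 :
  entry_cvg M M0 -> entry_cvg N N0 ->
  entry_cvg (fun t => M t *m N t) (M0 *m N0).
Proof.
move=> MM NN i j; under eq_fun do rewrite mxE.
by rewrite mxE; apply: cvg_sum_fin => k _; apply: cvgM.
Qed.

Lemma cvg_det a (M : T -> 'M[K]_a) M0 :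
  entry_cvg M M0 -> \det (M t) @[t --> F] --> \det M0.
Proof.
move=> MM; apply: cvg_sum_fin => s _; apply: cvgMl_tmp.
exact: cvg_prod_fin.
Qed.

Lemma entry_cvg_adj a (M : T -> 'M[K]_a) M0 :
  entry_cvg M M0 -> entry_cvg (fun t => \adj (M t)) (\adj M0).
Proof.
move=> MM i j; under eq_fun do rewrite mxE.
rewrite mxE; apply: cvgMl_tmp.
by apply: cvg_det => k l; under eq_fun do rewrite !mxE; rewrite !mxE; exact: MM.
Qed.

(** Multiplying [u t *m M t] by the adjugate and dividing by the determinant
recovers [u t], and adjugate and determinant are continuous. *)
Lemma entry_cvg_solve a b (u : T -> 'M[K]_(a, b)) (M : T -> 'M[K]_b)
    (w : 'M[K]_(a, b)) :
  entry_cvg M 1%:M -> entry_cvg (fun t => u t *m M t) w -> entry_cvg u w.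
Proof.
move=> M1 uMw.
have dM : (\det (M t))^-1 @[t --> F] --> (1 : K).
  rewrite -[X in _ --> X]invr1; apply: cvgV; first exact: oner_neq0.
  by rewrite -(det1 K b); exact: cvg_det.
have uadj := entry_cvgM uMw (entry_cvg_adj M1).
have adj1 : \adj (1%:M : 'M[K]_b) = 1%:M.
  by rewrite -[LHS]mulmx1 mul_adj_mx det1.
rewrite adj1 mulmx1 in uadj.
have d0 : \forall t \near F, \det (M t) != 0.
  apply: (cvgr_neq0 (1 : K)); last exact: oner_neq0.
  by rewrite -(det1 K b); exact: cvg_det.
move=> i j.
have duw : (\det (M t))^-1 * (u t *m M t *m \adj (M t)) i j @[t --> F] --> w i j.
  by rewrite -[w i j]mul1r; exact: cvgM dM (uadj i j).
apply: (near_cvg_to _ duw); apply: filterS d0 => t dt /=.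
by rewrite -mulmxA mul_mx_adj mul_mx_scalar mxE mulKf.
Qed.

Definition coef_row d (l : mpoly n K) : 'rV[K]_(#|{: bmultinom n d}|) :=
  \row_i mcoeff (val (enum_val i)) l.

(** Row [i] lists the coefficients of degree below [b] of [q] times the [i]-th
monomial: multiplication by [q], on polynomials of size at most [d], followed
by truncation at degree [b]. *)
Definition mulby_mx d b (q : mpoly n K) :
    'M[K]_(#|{: bmultinom n d}|, #|{: bmultinom n b}|) :=
  \matrix_(i, j) mcoeff (val (enum_val j)) (mpolyX K (val (enum_val i)) * q).

Definition poly_of_row d (v : 'rV[K]_(#|{: bmultinom n d}|)) : mpoly n K :=
  \sum_i v 0 i *: mpolyX K (val (enum_val i)).

Lemma msize_poly_of_row d v : (mpoly.msize (@poly_of_row d v) <= d)%N.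
Proof.
apply: leq_trans (@mmeasure_sum _ _ _ _ _ _ _) _.
apply/bigmax_leqP_seq => i _ _.
apply: leq_trans (@mmeasureZ_le _ _ _ _ _) _.
rewrite mmeasureX.
exact: bmdeg.
Qed.

Lemma poly_of_rowK d : cancel (@poly_of_row d) (@coef_row d).
Proof.
move=> v; apply/rowP => i; rewrite mxE /poly_of_row raddf_sum /=.
rewrite (bigD1 i) //= mcoeffZ mcoeffX eqxx mulr1 big1 ?addr0 // => j ji.
rewrite mcoeffZ mcoeffX; case: eqP => [/val_inj/enum_val_inj ij|]; last by rewrite mulr0.
by rewrite ij eqxx in ji.
Qed.

Lemma coef_rowK d l : (mpoly.msize l <= d)%N -> poly_of_row (coef_row d l) = l.
Proof.
move=> ld; rewrite [RHS](mpolywE ld) /poly_of_row.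
rewrite [RHS](reindex (@enum_val _ {: bmultinom n d})) /=; last first.
  by apply: onW_bij; exact: enum_val_bij.
by apply: eq_bigr => i _; rewrite mxE.
Qed.

Lemma poly_of_row_mulby d b v q :
  v *m mulby_mx d b q = coef_row b (poly_of_row v * q).
Proof.
apply/rowP => j; rewrite !mxE /poly_of_row mulr_suml raddf_sum /=.
by apply: eq_bigr => i _; rewrite mxE -scalerAl mcoeffZ.
Qed.

(** With this many columns nothing of a product with [q] is truncated, so
independence of the rows is the absence of zero divisors. *)
Lemma row_free_mulby_mx d q : q != 0 ->
  row_free (mulby_mx d (d + mpoly.msize q).+1 q).
Proof.
move=> q0; apply: inj_row_free => v; rewrite poly_of_row_mulby => vq0.
have {vq0} : poly_of_row v * q = 0.
  rewrite -(@coef_rowK (d + mpoly.msize q).+1 (_ * q)); last first.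
    apply: leq_trans (msizeM_le _ _) _.
    by rewrite ltnS leq_add2r msize_poly_of_row.
  by rewrite vq0 /poly_of_row big1 // => i _; rewrite mxE scale0r.
move=> /eqP; rewrite mulf_eq0 (negPf q0) orbF => /eqP v0.
by rewrite -(poly_of_rowK v) v0; apply/rowP => i; rewrite !mxE mcoeff0.
Qed.

(** The convergence of the [L t] comes out of the proof. A right inverse [B] of the
matrix of multiplication by [q] nearly inverts that of multiplication by [Q t],
so that their coefficients can be recovered from those of [L t * Q t]. *)
Lemma coef_cvg_quotient d L Q q w :
  (\forall t \near F, (mpoly.msize (L t) <= d)%N) -> coef_cvg Q q -> q != 0 ->
  coef_cvg (fun t => L t * Q t) w ->
  exists2 l, (mpoly.msize l <= d)%N & w = l * q.
Proof.
move=> Ld Qq q0 LQw.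
have [B qB] := row_freeP (row_free_mulby_mx d q0).
set b := (d + _).+1 in B qB.
pose u t := coef_row d (L t).
have M1 : entry_cvg (fun t => mulby_mx d b (Q t) *m B) 1%:M.
  rewrite -qB; apply: entry_cvgM => i j; last exact: cvg_cst.
  under eq_fun do rewrite mxE; rewrite mxE.
  by apply: coef_cvgM => // m; exact: cvg_cst.
have uM : entry_cvg (fun t => u t *m (mulby_mx d b (Q t) *m B)) (coef_row b w *m B).
  suff uw : entry_cvg (fun t => u t *m mulby_mx d b (Q t)) (coef_row b w).
    under eq_fun do rewrite mulmxA.
    by apply: entry_cvgM uw _ => i j; exact: cvg_cst.
  move=> i j; rewrite mxE; apply: (near_cvg_to _ (LQw _)).
  by apply: filterS Ld => t Lt; rewrite poly_of_row_mulby coef_rowK // mxE.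
have ucvg := entry_cvg_solve M1 uM.
exists (poly_of_row (coef_row b w *m B)); first exact: msize_poly_of_row.
apply: (coef_cvg_unique LQw); apply: coef_cvgM => // m.
apply: (@near_cvg_to (fun t => mcoeff m (poly_of_row (u t)))).
  by apply: filterS Ld => t Lt; rewrite coef_rowK.
under eq_fun do rewrite /poly_of_row raddf_sum /=.
rewrite /poly_of_row raddf_sum /=; apply: cvg_sum_fin => i _.
under eq_fun do rewrite mcoeffZ; rewrite mcoeffZ.
by apply: cvgMr_tmp; exact: ucvg.
Qed.

End CoefficientLimits.

(** * Derivatives and power series over a normed field *)

Section DerivativesOverNumFields.
Local Open Scope classical_set_scope.
Local Open Scope ring_scope.
Variable K : numFieldType.

Lemma is_derive_chain (f g : K -> K) (x df dg : K) :
  is_derive x 1 f df -> is_derive (f x) 1 g dg ->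
  is_derive x 1 (g \o f) (dg * df).
Proof.
move=> [/derivable1_diffP fx <-] [/derivable1_diffP gx <-].
have gfx := differentiable_comp fx gx.
apply: DeriveDef; first exact/derivable1_diffP.
rewrite -derive1E derive1E' // diff_comp //= -!derive1E !derive1E' //.
by rewrite -[X in 'd g _ X = _]mulr1 [LHS]linearZ mulrC.
Qed.

Lemma is_derive_quotient (g f : K -> K) (x dg df : K) :
  f x != 0 -> is_derive x 1 g dg -> is_derive x 1 f df ->
  is_derive x 1 (fun z => g z / f z) ((dg * f x - g x * df) / f x ^+ 2).
Proof.
move=> fx0 gx fxd.
have fV : is_derive x 1 (fun z => (f z)^-1) (- f x ^- 2 *: df).
  apply: DeriveDef; first by apply: derivableV.
  by rewrite deriveV // derive_val.
apply: is_derive_eq.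
by rewrite /GRing.scale /=; field.
Qed.

(** Freezing all variables except the [i]-th turns the formal partial derivative
into the derivative of a function of one variable. *)
Lemma is_derive_meval n (i : 'I_n) (v : 'I_n -> K) (p : mpoly n K) (x : K) :
  is_derive x 1 (fun z => meval (fun j => if j == i then z else v j) p)
    (meval (fun j => if j == i then x else v j) (mderiv i p)).
Proof.
elim/mpolyind: p => [|c m p _ _ IHp].
  rewrite mderiv0 meval0; under eq_fun do rewrite meval0.
  exact: is_derive_cst.
have mX z (k : multinom n) : meval (fun j => if j == i then z else v j) (mpolyX K k)
    = z ^+ k i * \prod_(j < n | j != i) v j ^+ k j.
  rewrite mevalX (bigD1 i) //= eqxx; congr (_ * _).
  by apply: eq_bigr => j /negPf ->.
rewrite mderivD mderivZ mderivX mevalD !mevalZ mX.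
under eq_fun do rewrite mevalD mevalZ mX.
apply: is_deriveD.
have -> : (mnm_sub m (mnm1 i)) i = (m i).-1.
  by rewrite mnmBE mnm1E eqxx subn1.
have -> : \prod_(j < n | j != i) v j ^+ (mnm_sub m (mnm1 i)) j =
          \prod_(j < n | j != i) v j ^+ m j.
  by apply: eq_bigr => j ji; rewrite mnmBE mnm1E eq_sym (negPf ji) subn0.
set P := \prod_(j < n | _) _.
have -> : (fun z : K => c * (z ^+ m i * P)) = (c * P) \*: (id : K -> K) ^+ m i.
  by apply/funext => z; rewrite /= exprfctE /GRing.scale /=; ring.
apply: is_derive_eq; rewrite /GRing.scale /=; ring.
Qed.

(** Terms bounded at [s] are dominated, at [z], by a geometric series of ratio
at most 1/2. *)
Lemma power_series_near0 (c : nat -> K) (s z M : K) (n : nat) :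
  s != 0 -> `|z / s| <= 2^-1 -> (forall k, `|c k * s ^+ k| <= M) ->
  `|\sum_(k < n.+1) c k * z ^+ k - c 0%N| <= 2 * M * `|z / s|.
Proof.
move=> s0 zs cM; set r := `|z / s|.
have r0 : 0 <= r by exact: normr_ge0.
have M0 : 0 <= M by exact: le_trans (normr_ge0 _) (cM 0%N).
have cr k : `|c k.+1 * z ^+ k.+1| <= M * r * 2^-1 ^+ k.
  have -> : c k.+1 * z ^+ k.+1 = c k.+1 * s ^+ k.+1 * (z / s) ^+ k.+1.
    by rewrite expr_div_n; field; rewrite expf_neq0.
  rewrite normrM normrX -/r [r ^+ _]exprS mulrA.
  apply: ler_pM; rewrite ?mulr_ge0 ?exprn_ge0 //; first by rewrite ler_wpM2r.
  by rewrite lerXn2r // nnegrE invr_ge0 ler0n.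
(* The exact sum of the dominating series is what induction on [n] needs. *)
apply: (@le_trans _ _ (2 * M * r * (1 - 2^-1 ^+ n))); last first.
  have p0 : 0 <= 2 * M * r by rewrite !mulr_ge0 ?ler0n.
  by apply: ler_piMr.
elim: n => [|n IHn].
  by rewrite big_ord1 expr0 mulr1 subrr normr0 subrr mulr0.
rewrite big_ord_recr /= addrAC; apply: le_trans (ler_normD _ _) _.
apply: (le_trans (lerD IHn (cr n))).
by rewrite le_eqVlt; apply/orP; left; apply/eqP; rewrite exprS; field.
Qed.

End DerivativesOverNumFields.

(** * Continuity of analytic functions of a real variable *)

Section RealAnalytic.
Local Open Scope classical_set_scope.
Local Open Scope ring_scope.
Local Open Scope complex_scope.
Variable R : realType.

Lemma norm_real_complex (x : R) : `|x%:C : Cx R| = `|x|%:C.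
Proof. by rewrite normc_def /= expr0n addr0 sqrtr_sqr. Qed.

Lemma normc_le_sum (a b : R) : `|(a +i* b : Cx R)| <= (`|a| + `|b|)%:C.
Proof.
rewrite normc_def /= lecR -[leRHS]ger0_norm ?addr_ge0 // -sqrtr_sqr.
apply: ler_wsqrtr; rewrite sqrrD !real_normK ?num_real // lerD2r lerDl.
by rewrite mulrn_wge0 // mulr_ge0.
Qed.

Lemma normc_ge_parts (a b : R) :
  `|a|%:C <= `|(a +i* b : Cx R)| /\ `|b|%:C <= `|(a +i* b : Cx R)|.
Proof.
by rewrite normc_def /= !lecR -!sqrtr_sqr; split; apply: ler_wsqrtr;
  rewrite ?lerDl ?lerDr sqr_ge0.
Qed.

(** In the partial order of the complex numbers a positive element is real: the
epsilons of complex limits are real ones. *)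
Lemma posc_real (e : Cx R) : 0 < e -> exists2 e0 : R, 0 < e0 & e = e0%:C.
Proof.
case: e => a b; rewrite ltcE /= => /andP[/eqP -> a0]; by exists a.
Qed.

Lemma nbhs0_real_of_complex (e : Cx R) : 0 < e ->
  \forall t \near (0 : R), `|t%:C : Cx R| <= e.
Proof.
move=> /posc_real[e0 e00 ->]; exists e0 => // t /=; rewrite sub0r normrN => te.
by rewrite norm_real_complex lecR ltW.
Qed.

(** The power series converges at [rho / 2], hence its terms are bounded there,
and [power_series_near0] compares its partial sums with the constant term. *)
Lemma real_analytic_at_cvg (u : R -> Cx R) :
  real_analytic_at u 0 -> u t @[t --> (0 : R)^'] --> u 0.
Proof.
move=> [rho rho0 [c uc]].
have sum0 : u 0 = c 0%N.
  have := uc 0; rewrite subrr normr0 => /(_ rho0) uc0.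
  apply: (cvg_unique (@norm_hausdorff _ (Cx R)) uc0).
  apply: cvg_near_cst; near=> n; rewrite /series /=.
  have n0 : (0 < n)%N by near: n; exact: nbhs_infty_gt.
  rewrite -(prednK n0) big_nat_recl //= big1 ?addr0 ?expr0 ?mulr1 // => i _.
  by rewrite exprS mul0r mulr0.
pose s : R := rho / 2.
have s0 : 0 < s by rewrite divr_gt0.
have sC0 : (s%:C : Cx R) != 0 by rewrite (inj_eq (@complexI _)) gt_eqF.
have [M0 [M0r cM]] : bounded_fun (fun n => c n * (s%:C : Cx R) ^+ n).
  apply: cvg_seq_bounded; apply/cvg_ex; exists (0 : Cx R).
  apply: cvg_series_cvg_0; apply/cvg_ex; exists (u s).
  have := uc s; rewrite subr0 gtr0_norm // => /(_ _).
  under eq_fun do rewrite rmorphXn; apply.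
  by rewrite /s ltr_pdivrMr // ltr_pMr // ltr1n.
pose M := `|M0| + 1.
have M_gt0 : 0 < M by rewrite ltr_wpDl.
have {}cM k : `|c k * (s%:C : Cx R) ^+ k| <= M.
  by apply: cM => //; rewrite ltr_pwDr // real_ler_norm.
apply/cvgrPdist_le => e e0.
apply: nbhs_dnbhs.
near=> t.
have trho : `|t| < rho by near: t; exact: (@nbhs0_lt _ R).
have ut : series (fun n => c n * (t%:C : Cx R) ^+ n) @ \oo --> u t.
  by have := uc t; rewrite subr0 => /(_ trho); under eq_fun do rewrite rmorphXn.
move/cvgrPdist_le : ut => /(_ (e / 2)); rewrite divr_gt0 ?ltr0n // => /(_ isT).
case=> N _ /(_ N.+1 (leqnSn N)) uN.
rewrite sum0 distrC.
have -> : u t - c 0%N = (u t - series (fun n => c n * (t%:C : Cx R) ^+ n) N.+1)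
   + (series (fun n => c n * (t%:C : Cx R) ^+ n) N.+1 - c 0%N) by rewrite addrA subrK.
apply: le_trans (ler_normD _ _) _; rewrite [leRHS](splitr e).
apply: lerD => //.
have ts2 : `|(t%:C : Cx R) / s%:C| <= 2^-1.
  rewrite normf_div ler_pdivrMr ?normr_gt0 //.
  near: t; apply: nbhs0_real_of_complex.
  by rewrite mulr_gt0 ?normr_gt0 // invr_gt0 ltr0n.
rewrite /series /= big_mkord.
apply: le_trans (power_series_near0 _ sC0 ts2 cM) _.
rewrite normf_div mulrA ler_pdivrMr ?normr_gt0 // mulrC -ler_pdivlMr ?mulr_gt0 ?ltr0n //.
near: t; apply: nbhs0_real_of_complex.
by rewrite !divr_gt0 ?mulr_gt0 ?normr_gt0 ?ltr0n.
Unshelve. all: by end_near. Qed.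

End RealAnalytic.

(** * The derivative of the complex exponential *)

Section ComplexExponential.
Local Open Scope classical_set_scope.
Local Open Scope ring_scope.
Local Open Scope complex_scope.
Variable R : realType.

Lemma is_derive0_bound (f : R -> R) (d e : R) : is_derive (0 : R) (1 : R) f d -> 0 < e ->
  \forall t \near (0 : R), `|f t - f 0 - d * t| <= e * `|t|.
Proof.
move=> [f1 fd] e0.
have : h^-1 *: ((f \o shift 0) (h *: (1 : R)) - f 0) @[h --> (0 : R)^'] --> d.
  by rewrite -fd; exact: f1.
move=> /cvgrPdist_le/(_ e e0).
rewrite !near_withinE => H; near=> t.
have [->|t0] := eqVneq t 0; first by rewrite subrr mulr0 subrr normr0 mulr0.
have /(_ t0) : t != 0 -> `|d - t^-1 *: ((f \o shift 0) (t *: (1 : R)) - f 0)| <= e.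
  by near: t.
rewrite /= addr0 /GRing.scale /= mulr1 => He.
rewrite distrC.
have -> : d * t - (f t - f 0) = (d - t^-1 * (f t - f 0)) * t by field.
by rewrite normrM ler_wpM2r.
Unshelve. all: by end_near. Qed.

Lemma cexpD (z w : Cx R) : cexp (z + w) = cexp z * cexp w.
Proof.
case: z => a b; case: w => c d; rewrite /cexp /= expRD cosD sinD.
by congr (_ +i* _); ring.
Qed.

Lemma cexp_neq0 (z : Cx R) : cexp z != 0.
Proof.
apply/eqP => z0; have := cexpD z (- z); rewrite z0 mul0r subrr => /eqP.
by rewrite /cexp /= expR0 cos0 sin0 mulr0 mulr1 eq_complex /= oner_eq0.
Qed.

(** With h = a + ib, the real and imaginary parts of exp(h) - 1 - h are
(e^a - 1 - a) cos b + (1 + a) (cos b - 1) and e^a (sin b - b) + (e^a - 1) b,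
in which each summand is small compared with |h| by the first-order expansions
at 0 of the real functions exp, cos and sin. *)
Lemma cexp_near0 (e : R) : 0 < e ->
  \forall h \near (0 : Cx R), `|cexp h - 1 - h| <= e%:C * `|h|.
Proof.
move=> e0.
(* The parts are at most k (|a| + 2 |b|) and 3 k |b|, in total at most 6 k |h|. *)
pose k := Num.min (e / 6) 1.
have k0 : 0 < k by rewrite lt_min ltr01 andbT divr_gt0.
have k1 : k <= 1 by rewrite ge_min lexx orbT.
have ke : 6 * k <= e.
  by rewrite mulrC -ler_pdivlMr // ge_min lexx.
have hE := is_derive0_bound (is_derive_expR 0) k0.
have hC := is_derive0_bound (is_derive_cos 0) k0.
have hS := is_derive0_bound (is_derive_sin 0) k0.
have hk : \forall t \near (0 : R), `|t| < k / 2.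
  by apply: nbhs0_lt; rewrite divr_gt0.
have := filterI (filterI hE hC) (filterI hS hk).
move=> [r /= r0 Hr]; exists r%:C; first by rewrite /= ltcR.
case=> a b /=; rewrite sub0r normrN => hr.
have [ha hb] := normc_ge_parts a b.
have [|[Ea _] [_ ak]] := Hr a.
  by rewrite /= sub0r normrN -ltcR; exact: le_lt_trans ha hr.
have [|[_ Cb] [Sb _]] := Hr b.
  by rewrite /= sub0r normrN -ltcR; exact: le_lt_trans hb hr.
move: Ea Cb Sb; rewrite expR0 cos0 sin0 !subr0 oppr0 mul0r !mul1r subr0 => Ea Cb Sb.
have Ea1 : `|expR a - 1| <= k.
  rewrite -[_ - 1](subrK a); apply: le_trans (ler_normD _ _) _.
  apply: le_trans (lerD Ea (lexx _)) _.
  have : k * `|a| <= `|a| by rewrite ler_piMl.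
  by move: ak; lra.
have E2 : `|expR a| <= 2.
  by rewrite -[expR a](subrK 1); apply: le_trans (ler_normD _ _) _; rewrite normr1; lra.
have -> : cexp (a +i* b) - 1 - (a +i* b) =
    (expR a * cos b - 1 - a) +i* (expR a * sin b - b) :> R[i].
  by rewrite /cexp /=; congr (_ +i* _); rewrite ?subr0.
apply: le_trans (normc_le_sum _ _) _.
have Re_bound : `|expR a * cos b - 1 - a| <= k * `|a| + 2 * k * `|b|.
  have -> : expR a * cos b - 1 - a = (expR a - 1 - a) * cos b + (1 + a) * (cos b - 1).
    by ring.
  apply: le_trans (ler_normD _ _) _; rewrite !normrM; apply: lerD.
    by rewrite -[leRHS]mulr1 ler_pM // cos_max.
  rewrite -mulrA ler_pM //; apply: le_trans (ler_normD _ _) _.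
  by rewrite normr1; move: ak; lra.
have Im_bound : `|expR a * sin b - b| <= 3 * k * `|b|.
  have -> : expR a * sin b - b = expR a * (sin b - b) + (expR a - 1) * b by ring.
  apply: le_trans (ler_normD _ _) _; rewrite !normrM.
  have : `|expR a| * `|sin b - b| <= 2 * (k * `|b|) by rewrite ler_pM.
  have : `|expR a - 1| * `|b| <= k * `|b| by rewrite ler_pM.
  by lra.
set hn := `|(a +i* b : Cx R)| in ha hb hr *.
have hnE : hn = (complex.Re hn)%:C by rewrite /hn normc_def.
move: ha hb; rewrite hnE -rmorphM !lecR; set H := complex.Re hn => ha hb.
have : k * `|a| <= k * H by rewrite ler_pM2l.
have : k * `|b| <= k * H by rewrite ler_pM2l.
have : 6 * k * H <= e * H by rewrite ler_wpM2r // (le_trans _ ha).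
move: Re_bound Im_bound; rewrite -!mulrA.
by lra.
Qed.

Lemma is_derive_cexp (z : Cx R) : is_derive z 1 (@cexp R) (cexp z).
Proof.
have lim : h^-1 *: ((@cexp R \o shift z) (h *: (1 : Cx R)) - cexp z)
    @[h --> (0 : Cx R)^'] --> cexp z.
  have lim1 : (cexp h - 1) / h @[h --> (0 : Cx R)^'] --> (1 : Cx R).
    apply/cvgrPdist_le => _ /posc_real[e e0 ->].
    rewrite !near_withinE; near=> h => h0.
    have -> : 1 - (cexp h - 1) / h = - ((cexp h - 1 - h) / h) by field.
    rewrite normrN normf_div ler_pdivrMr ?normr_gt0 //.
    by near: h; exact: cexp_near0.
  have -> : (fun h : Cx R => h^-1 *: ((@cexp R \o shift z) (h *: (1 : Cx R)) - cexp z))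
     = (fun h => cexp z * ((cexp h - 1) / h)).
    apply/funext => h; rewrite /= {1}/GRing.scale /= /GRing.scale /= mulr1 cexpD.
    by ring.
  by rewrite -[X in _ --> X]mulr1; exact: cvgMl_tmp.
apply: DeriveDef; first by apply/cvg_ex; exists (cexp z).
exact: cvg_lim lim.
Unshelve. all: by end_near. Qed.

End ComplexExponential.

(** * Degrees of cofactors *)

Section Cofactors.
Local Open Scope ring_scope.

Lemma msize_mderiv n (A : nzRingType) (i : 'I_n) (p : mpoly n A) :
  (mpoly.msize (mderiv i p) <= (mpoly.msize p).-1)%N.
Proof.
rewrite msizeE; apply/bigmax_leqP_seq => m; rewrite mcoeff_msupp mcoeff_deriv => mp _.
have : mnm_add m (mnm1 i) \in msupp p.
  by rewrite mcoeff_msupp; apply: contraNneq mp => ->; rewrite mul0rn.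
by move=> /msize_mdeg_lt; rewrite mdegD mdeg1 addn1; case: (mpoly.msize p).
Qed.

Variable R : realType.
Implicit Types (X : vfield R) (f g p q L : poly2 R).

Lemma vf_appB X p q : vf_app X (p - q) = vf_app X p - vf_app X q.
Proof. by rewrite /vf_app !mderivB; ring. Qed.

Lemma vf_appZ X c p : vf_app X (c *: p) = c *: vf_app X p.
Proof. by rewrite /vf_app !mderivZ scalerDr -!scalerAr. Qed.

(** Deriving lowers the degree of [f] by one, multiplying by a coefficient of
[X] raises it by at most [d]; this holds also for [d = 0], where [L] is 0. *)
Lemma msize_cofactor d X f L :
  vf_has_degree d X -> f != 0 -> vf_app X f = L * f -> (mpoly.msize L <= d)%N.
Proof.
move=> Xd f0 XfL; have [->|L0] := eqVneq L 0; first by rewrite msize0.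
have f1 : (0 < mpoly.msize f)%N by rewrite lt0n mmeasure_poly_eq0.
have bound a i : (mpoly.msize a <= d.+1)%N ->
    (mpoly.msize (a * mderiv i f) <= (d + mpoly.msize f).-1)%N.
  have [->|a0] := eqVneq a 0; first by rewrite mul0r msize0.
  have [->|fi0] := eqVneq (mderiv i f) 0; first by rewrite mulr0 msize0.
  move=> ad; rewrite msizeM // -!subn1 leq_sub2r //.
  by apply: leq_trans (leq_add ad (msize_mderiv i f)) _; rewrite addSnnS prednK.
have : (mpoly.msize (L * f) <= (d + mpoly.msize f).-1)%N.
  rewrite -XfL; apply: leq_trans (mmeasureD_le _ _ _) _.
  have [X1d X2d] : (mpoly.msize X.1 <= d.+1)%N /\ (mpoly.msize X.2 <= d.+1)%N.
    by split; rewrite -Xd; [exact: leq_maxl|exact: leq_maxr].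
  by rewrite geq_max; apply/andP; split; exact: bound.
by rewrite msizeM // -(prednK f1) !addnS /= leq_add2r.
Qed.

End Cofactors.

(** * The action of a vector field on exp(g/f) *)

Section ExponentialOfQuotient.
Local Open Scope classical_set_scope.
Local Open Scope ring_scope.
Local Open Scope complex_scope.
Variable R : realType.
Implicit Types (X : vfield R) (f g p q L : poly2 R).

Lemma ev2D p q (x y : Cx R) : ev2 (p + q) x y = ev2 p x y + ev2 q x y.
Proof. exact: mevalD. Qed.

Lemma ev2B p q (x y : Cx R) : ev2 (p - q) x y = ev2 p x y - ev2 q x y.
Proof. exact: mevalB. Qed.

Lemma ev2M p q (x y : Cx R) : ev2 (p * q) x y = ev2 p x y * ev2 q x y.
Proof. exact: mevalM. Qed.

Lemma ev2_vf_app X p (x y : Cx R) :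
  ev2 (vf_app X p) x y =
  ev2 X.1 x y * ev2 (mderiv varx p) x y + ev2 X.2 x y * ev2 (mderiv vary p) x y.
Proof.
rewrite /vf_app; etransitivity; first exact: ev2D.
by congr (_ + _); exact: ev2M.
Qed.

Lemma is_derive_ev2x p (x y : Cx R) :
  is_derive x 1 (fun z => ev2 p z y) (ev2 (mderiv varx p) x y).
Proof. exact: is_derive_meval. Qed.

Lemma is_derive_ev2y p (x y : Cx R) :
  is_derive y 1 (fun z => ev2 p x z) (ev2 (mderiv vary p) x y).
Proof.
have swap q z : ev2 q x z = meval (fun i => if i == vary then z else x) q.
  by apply: meval_eq => i; rewrite !eqE /=; case: i => [[|[|]]].
rewrite swap; under eq_fun do rewrite swap.
exact: is_derive_meval.
Qed.

Lemma derive1_exp_quotient (g f : Cx R -> Cx R) (x dg df : Cx R) :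
  f x != 0 -> is_derive x 1 g dg -> is_derive x 1 f df ->
  (fun z => cexp (g z / f z))^`()%classic x =
  cexp (g x / f x) * ((dg * f x - g x * df) / f x ^+ 2).
Proof.
move=> fx0 gx fx; rewrite derive1E.
have := is_derive_chain (is_derive_quotient fx0 gx fx) (is_derive_cexp _).
by move=> h; exact: derive_val.
Qed.

(** The algebra of the chain rule: [e] stands for exp(g/f), and the subscripts x
and y for partial derivatives. *)
Lemma quotient_derivation_eq (K : fieldType) (a b g gx gy f fx fy Xg Xf e l : K) :
  f != 0 -> e != 0 -> Xg = a * gx + b * gy -> Xf = a * fx + b * fy ->
  Xg * f - g * Xf = l * (f * f) ->
  (a * (e * ((gx * f - g * fx) / f ^+ 2)) +
   b * (e * ((gy * f - g * fy) / f ^+ 2))) / e = l.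
Proof.
move=> f0 e0 -> -> E; apply: (mulIf (mulf_neq0 f0 f0)); rewrite -E.
by field; rewrite f0 e0.
Qed.

(** The equation says X(g/f) = L, without denominators. *)
Lemma exponential_coefficient_of_eq d X f g L :
  f != 0 -> (mpoly.msize L <= d)%N ->
  vf_app X g * f - g * vf_app X f = L * (f * f) ->
  exponential_coefficient d X g f.
Proof.
move=> f0 Ld XL; split=> //; exists L => // x y fxy.
rewrite /vf_app_fun /exp_frac.
rewrite (derive1_exp_quotient (f := fun z => ev2 f z y) fxy
  (is_derive_ev2x g x y) (is_derive_ev2x f x y)).
rewrite (derive1_exp_quotient (f := fun z => ev2 f x z) fxy
  (is_derive_ev2y g x y) (is_derive_ev2y f x y)).
have ev2_eq u v : u * f - g * v = L * (f * f) ->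
    ev2 u x y * ev2 f x y - ev2 g x y * ev2 v x y =
    ev2 L x y * (ev2 f x y * ev2 f x y).
  by move=> /(congr1 (fun p => ev2 p x y)); rewrite ev2B !ev2M.
exact: (quotient_derivation_eq fxy (cexp_neq0 _)
  (ev2_vf_app X g x y) (ev2_vf_app X f x y) (ev2_eq _ _ XL)).
Qed.

End ExponentialOfQuotient.

(** * The limit of the difference quotients of cofactors *)

Section LimitOfCofactors.
Local Open Scope classical_set_scope.
Local Open Scope ring_scope.
Local Open Scope complex_scope.
Variable R : realType.
Implicit Types (X : vfield R) (f g p q L : poly2 R).

Lemma coef_cvg_vf_app (F : set_system R) {FF : ProperFilter F}
    (Xt : R -> vfield R) X (P : R -> poly2 R) p :
  coef_cvg F (fun t => (Xt t).1) X.1 -> coef_cvg F (fun t => (Xt t).2) X.2 ->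
  coef_cvg F P p ->
  coef_cvg F (fun t => vf_app (Xt t) (P t)) (vf_app X p).
Proof.
move=> X1 X2 Pp.
rewrite /vf_app; apply: coef_cvgD; apply: coef_cvgM.
- exact: X1.
- exact: coef_cvg_deriv.
- exact: X2.
- exact: coef_cvg_deriv.
Qed.

(** The cofactor is the limit of (K2 - K1) / t^r, where K1 and K2 are the
cofactors of the two curves. *)
Lemma curve_derivative_cofactor d X f g :
  f != 0 -> curve_derivative d X f g ->
  exists2 L, (mpoly.msize L <= d)%N &
    vf_app X g * f - g * vf_app X f = L * (f * f).
Proof.
move=> fn0 [eps [Xt [f1 [f2 [r [[eps0 Xan X0] inv [f1f f2f] [_ _ hg _]]]]]]].
pose h t := ((t ^+ r)%:C : Cx R)^-1 *: (f2 t - f1 t).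
have near0 : \forall t \near (0 : R)^', `|t| < eps /\ t != 0.
  by rewrite near_withinE; apply: filterS (nbhs0_lt eps0) => t te t0.
have /choice[L HL] : forall t, exists l, `|t| < eps /\ t != 0 ->
    (mpoly.msize l <= d)%N /\
    vf_app (Xt t) (h t) * f1 t - h t * vf_app (Xt t) (f1 t) = l * (f1 t * f2 t).
  move=> t; have [[te t0]|nt] := pselect (`|t| < eps /\ t != 0); last by exists 0.
  have [[f10 [K1 XK1]] [f20 [K2 XK2]] _] := inv t te t0.
  have [Xd _] := Xan t te.
  exists (((t ^+ r)%:C : Cx R)^-1 *: (K2 - K1)) => _; split.
    apply: leq_trans (@mmeasureZ_le _ _ _ _ _) _.
    apply: leq_trans (@mmeasureD_le _ _ _ _ _) _.
    by rewrite mmeasureN geq_max (msize_cofactor Xd f20 XK2) (msize_cofactor Xd f10 XK1).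
  rewrite /h vf_appZ vf_appB XK1 XK2 -!scalerAl -scalerBr; congr (_ *: _).
  by ring.
have e0 : `|0 : R| < eps by rewrite normr0.
have X1 : coef_cvg (0 : R)^' (fun t => (Xt t).1) X.1.
  by move=> m; have [_ /(_ m)[/real_analytic_at_cvg + _]] := Xan 0 e0; rewrite X0.
have X2 : coef_cvg (0 : R)^' (fun t => (Xt t).2) X.2.
  by move=> m; have [_ /(_ m)[_ /real_analytic_at_cvg]] := Xan 0 e0; rewrite X0.
have hh : coef_cvg (0 : R)^' h g by exact: hg.
apply: (@coef_cvg_quotient _ _ _ (0 : R)^' _ d L (fun t => f1 t * f2 t)).
- by apply: filterS near0 => t /HL[].
- by apply: coef_cvgM; [exact: f1f|exact: f2f].
- by rewrite mulf_neq0.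
apply: (@near_eq_coef_cvg _ _ _ (0 : R)^' _
  (fun t => vf_app (Xt t) (h t) * f1 t - h t * vf_app (Xt t) (f1 t))).
  by apply: filterS near0 => t /HL[].
apply: coef_cvgB; apply: coef_cvgM.
- by apply: coef_cvg_vf_app; [exact: X1|exact: X2|exact: hh].
- exact: f1f.
- exact: hh.
- by apply: coef_cvg_vf_app; [exact: X1|exact: X2|exact: f1f].
Qed.

End LimitOfCofactors.

Theorem theorem2 (R : realType) (d : nat) (X : vfield R) (f g : poly2 R)
    (hX : vf_has_degree d X) (hf : invariant_curve X f)
    (hg : curve_derivative d X f g) :
  exponential_coefficient d X g f.
Proof.
have [f0 _] := hf; have [L Ld XL] := curve_derivative_cofactor f0 hg.
exact: exponential_coefficient_of_eq f0 Ld XL.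
Qed.
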